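(* Let $\Gamma$ be an oval whose support function $p$ has a convergent and twice differentiable Fourier series, and suppose $\Gamma$ has degree $m$. Let $\overline{w}$ be the average width of $\Gamma$, let $\rho(t)=p(t)+p''(t)$ be its radius of curvature, and let $\overline{\rho}=\frac{1}{2\pi}\int_0^{2\pi}\rho(t)\,dt$ be its average radius of curvature. Then for all $t$ $$\sum_{k=0}^{2^m-1}\rho\big(t+2\pi k/2^m\big)=2^{m-1}\,\overline{w},$$ $$\overline{\rho}=\frac{\overline{w}}{2},$$ $$0\le\rho(t)\le 2^{m-1}\,\overline{w}.$$
   Context: An oval is a simple closed convex plane curve $\Gamma$; the origin is chosen in its interior. The support function $p(t)$, a $2\pi$-periodic function, is the distance from the origin to the tangent line of $\Gamma$ whose perpendicular from the origin makes angle $t$ with the positive $x$-axis (i.e. with outward normal $(\cos t,\sin t)$). The point of $\Gamma$ with parameter $t$ is $x(t)=p(t)\cos t-p'(t)\sin t$, $y(t)=p(t)\sin t+p'(t)\cos t$. The radius of curvature is $\rho(t)=p(t)+p''(t)$, and convexity of $\Gamma$ is equivalent to $\rho(t)\ge 0$ for all $t$. The instantaneous width is $w(t)=p(t)+p(t+\pi)$ and the average width is $\overline{w}=\frac1\pi\int_0^\pi w(t)\,dt=\frac{1}{\pi}\int_0^{2\pi}p(t)\,dt$. For an integer $m\ge 0$ put $$\overline{p}_m(t)=\frac1{2^m}\sum_{k=0}^{2^m-1}p(t+2\pi k/2^m).$$ The degree of the oval is the least integer $m\ge0$ for which $\overline{p}_m(t)$ does not depend on $t$. *)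

(* Defs.v *)
From mathcomp Require Export all_boot all_order all_algebra.
From mathcomp Require Export all_classical all_reals all_analysis.
Export numFieldNormedType.Exports.

Set Implicit Arguments.
Unset Strict Implicit.
Unset Printing Implicit Defensive.

Import Order.TTheory GRing.Theory Num.Theory.

Local Open Scope classical_set_scope.
Local Open Scope ring_scope.

(* The Euclidean structure is spelled out because the library norm on R * R is
   the sup norm; both induce the same topology. *)
Definition dot (R : realType) (q u : R * R) : R := q.1 * u.1 + q.2 * u.2.

Definition enorm (R : realType) (q : R * R) : R := Num.sqrt (dot q q).

Definition unit_vec (R : realType) (t : R) : R * R := (cos t, sin t).

Definition simple_closed_curve (R : realType) (G : set (R * R)) : Prop :=
  exists gamma : R -> R * R,
    [/\ {within `[0, 1], continuous gamma},
        gamma 0 = gamma 1,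
        {in `[0, 1[ &, injective gamma} &
        G = gamma @` `[0, 1]].

(* A simple closed convex curve is one bounding a convex region K; K is
   determined by G, and its topological interior is the interior of the oval. *)
Definition oval (R : realType) (G : set (R * R)) : Prop :=
  simple_closed_curve G /\
  exists K : set (R * R),
    [/\ @convex_set R (R * R)%type K, compact K,
        G = K `\` interior K & interior K (0, 0)].

Definition line (R : realType) (t c : R) : set (R * R) :=
  [set q | dot q (unit_vec t) = c].

(* L is the tangent (i.e. supporting) line of G with outward normal
   (cos t, sin t). At a corner of G every supporting line counts as tangent, so
   that there is exactly one tangent line for each direction t. *)
Definition tangent_line (R : realType) (G : set (R * R)) (t : R)
    (L : set (R * R)) : Prop :=
  exists c : R,
    [/\ L = line t c, L `&` G !=set0 &
        forall q, G q -> dot q (unit_vec t) <= c].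

Definition dist_origin (R : realType) (L : set (R * R)) : R :=
  inf [set enorm q | q in L].

Definition support_function (R : realType) (G : set (R * R)) (p : R -> R) :
    Prop :=
  forall t, exists2 L, tangent_line G t L & p t = dist_origin L.

Definition integral (R : realType) (a b : R) (f : R -> R) : R :=
  Rintegral (@lebesgue_measure R) `[a, b] f.

Definition fourier_cos (R : realType) (p : R -> R) (n : nat) : R :=
  pi^-1 * integral 0 (2 * pi) (fun t => p t * cos (n%:R * t)).

Definition fourier_sin (R : realType) (p : R -> R) (n : nat) : R :=
  pi^-1 * integral 0 (2 * pi) (fun t => p t * sin (n%:R * t)).

Definition fourier_partial_sum (R : realType) (p : R -> R) (t : R) (N : nat) :
    R :=
  fourier_cos p 0 / 2 +
  \sum_(1 <= n < N.+1) (fourier_cos p n * cos (n%:R * t) +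
                        fourier_sin p n * sin (n%:R * t)).

(* The Fourier series of p converges to p everywhere, and its sum p is
   everywhere twice differentiable; p'' is not required to be continuous, nor is
   the series required to be differentiable term by term. *)
Definition twice_differentiable_fourier_series (R : realType) (p : R -> R) :
    Prop :=
  [/\ forall t, fourier_partial_sum p t @ \oo --> p t,
      forall t : R, derivable p t 1 &
      forall t : R, derivable (derive1 p) t 1].

Definition width (R : realType) (p : R -> R) (t : R) : R := p t + p (t + pi).

Definition average_width (R : realType) (p : R -> R) : R :=
  pi^-1 * integral 0 pi (width p).

Definition curvature_radius (R : realType) (p : R -> R) (t : R) : R :=
  p t + derive1n 2 p t.

(* Lebesgue integral: an everywhere defined, bounded p'' can fail to be Riemann
   integrable. *)
Definition average_curvature_radius (R : realType) (p : R -> R) : R :=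
  (2 * pi)^-1 * integral 0 (2 * pi) (curvature_radius p).

Definition shift_average (R : realType) (p : R -> R) (m : nat) (t : R) : R :=
  (2 ^+ m)^-1 * \sum_(k < 2 ^ m) p (t + 2 * pi * k%:R / 2 ^+ m).

Definition shift_average_constant (R : realType) (p : R -> R) (m : nat) :
    Prop :=
  forall s t, shift_average p m s = shift_average p m t.

Definition has_degree (R : realType) (p : R -> R) (m : nat) : Prop :=
  shift_average_constant p m /\
  forall l, shift_average_constant p l -> (m <= l)%N.

(* Main.v *)
Require Import Defs.
From mathcomp Require Import ring lra measurable_realfun.

Set Implicit Arguments.
Unset Strict Implicit.
Unset Printing Implicit Defensive.

Import Order.TTheory GRing.Theory Num.Theory.

Local Open Scope classical_set_scope.
Local Open Scope ring_scope.

(** Write u(t) for the unit vector of direction t and h = 2 pi / 2^m.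

    Since the origin is inside the oval, p(t) is nonnegative and is the maximum
    of q |-> <q, u(t)> over the curve ([support_function_max]). If q is a point
    where the maximum for the direction t is attained, the function
    s |-> p(s) - <q, u(s)> is nonnegative and vanishes at t; its second
    derivative at t, which is p''(t) + <q, u(t)> = p''(t) + p(t), is therefore
    nonnegative ([curvature_radius_ge0]).

    Degree m means that the sum of the p(t + k h), k < 2^m, is a constant C.
    Differentiating twice, the p''(t + k h) add up to 0
    ([sum_shift_derive_eq0]), so the rho(t + k h) add up to C as well. Both p
    and rho are nonnegative and measurable, so their integrals over [0, 2 pi]
    can be folded onto [0, h] ([integral_fold]), where the integrand is the
    constant C; both integrals are thus equal to C h. It follows that the
    average width is 2 C / 2^m and that the average of rho is half of it, with
    neither the integrability of p'' nor the fundamental theorem of calculus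
    being needed. The upper bound on rho(t) holds because rho(t) is one term of
    a sum of nonnegative terms equal to C. *)

(** * Integrals of translates *)

Lemma measurable_translate (R : realType) (h : R) :
  measurable_fun [set: R] (+%R^~ h).
Proof.
exact: (measurable_funD (@measurable_id _ _ _) (@measurable_cst _ _ _ _ _ h)).
Qed.

Lemma lebesgue_measure_translate (R : realType) (h : R) (A : set R) :
  measurable A ->
  pushforward (@lebesgue_measure R) (+%R^~ h : _ -> measurableTypeR R) A
    = lebesgue_measure A.
Proof.
move=> mA.
have mphi : measurable_fun setT
    (+%R^~ h : measurableTypeR R -> measurableTypeR R).
  exact: measurable_translate.
(* it is enough to compare both measures on the intervals `]a, b] *)
apply/esym/lebesgue_measure_unique => //= _ [[a b]] _ <-.
rewrite /pushforward (_ : _ @^-1` _ = `](a - h), (b - h)]%classic).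
  rewrite !lebesgue_measure_itv /= !lte_fin ltrD2r.
  by rewrite -!EFinB (_ : b - h - (a - h) = b - a)//; ring.
by apply/seteqP; split => x /=; rewrite !in_itv /= ltrBlDr lerBrDr.
Qed.

Lemma ge0_integral_translate (R : realType) (h : R) (D : set R)
    (f : R -> \bar R) :
  measurable D -> measurable_fun setT f -> (forall x, 0 <= f x)%E ->
  (\int[lebesgue_measure]_(x in D) f x =
   \int[lebesgue_measure]_(x in +%R^~ h @^-1` D) f (x + h)%R)%E.
Proof.
move=> mD mf f0.
have mphi : measurable_fun setT
    (+%R^~ h : measurableTypeR R -> measurableTypeR R).
  exact: measurable_translate.
transitivity (\int[pushforward (@lebesgue_measure R)
    (+%R^~ h : measurableTypeR R -> measurableTypeR R)]_(x in D) f x)%E.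
  apply: eq_measure_integral => //= A mA AS.
  exact/esym/lebesgue_measure_translate.
by rewrite ge0_integral_pushforward //; exact: measurable_funS mf.
Qed.

(** The integral over [0, N h] is cut into N intervals of length h, each of
    which is translated back to [0, h]. *)
Lemma integral_fold (R : realType) (f : R -> R) (h : R) (N : nat) :
  measurable_fun setT f -> (forall x, 0 <= f x) -> 0 <= h ->
  integral 0 (h * N%:R) f =
  integral 0 h (fun x => \sum_(k < N) f (x + h * k%:R)).
Proof.
move=> mf f0 h0.
have mfk k : measurable_fun setT (fun x : R => f (x + h * k%:R)).
  by apply: measurableT_comp => //; exact: measurable_translate.
rewrite /integral /Rintegral; congr fine.
(* half-open intervals make the pieces disjoint *)
rewrite -!integral_itv_bndo_bndc; last 2 first.
- apply/measurable_EFinP; apply: measurable_funTS.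
  by apply: measurable_sum => k; exact: mfk.
- by apply/measurable_EFinP; exact: measurable_funTS.
elim: N => [|N IHN].
  rewrite mulr0 set_itv_ge ?bnd_simp ?ltxx // integral_set0.
  by under eq_integral do rewrite big_ord0; rewrite integral0.
have hN : 0 <= h * N%:R by rewrite mulr_ge0 // ler0n.
rewrite (@itv_bndbnd_setU _ _ _ (BLeft (h * N%:R))); last 2 first.
- by rewrite bnd_simp.
- by rewrite bnd_simp ler_wpM2l // ler_nat.
rewrite ge0_integral_setU //=; last 3 first.
- by apply/measurable_EFinP; exact: measurable_funTS.
- by move=> x _; rewrite lee_fin.
- apply/disj_setPLR => x /=; rewrite !in_itv /= => /andP[_ +].
  by rewrite ltNge => /negP xN /andP[].
under [in RHS]eq_integral do rewrite big_ord_recr /= EFinD.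
rewrite ge0_integralD //=; last 4 first.
- by move=> x _; rewrite lee_fin sumr_ge0.
- apply/measurable_EFinP; apply: measurable_funTS.
  by apply: measurable_sum => k; exact: mfk.
- by move=> x _; rewrite lee_fin.
- apply/measurable_EFinP; apply: measurable_funTS; exact: mfk.
rewrite IHN; congr (_ + _)%E.
rewrite (@ge0_integral_translate _ (h * N%:R)) //; last first.
  exact/measurable_EFinP.
suff -> : +%R^~ (h * N%:R) @^-1` `[h * N%:R, h * N.+1%:R[ =
  `[0, h[%classic by [].
by apply/seteqP; split => x /=; rewrite !in_itv /= -natr1; lra.
Qed.

(** * Derivatives *)

Lemma derivable_continuous (R : realType) (f : R -> R) :
  (forall x, derivable f x 1) -> continuous f.
Proof. by move=> df x; exact/differentiable_continuous/derivable1_diffP. Qed.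

Lemma is_derive_derive1 (R : realType) (f : R -> R) (x : R) :
  derivable f x 1 -> is_derive x 1 f (derive1 f x).
Proof. by move=> df; rewrite derive1E; exact (derivableP df). Qed.

Lemma cvg_difference_quotient (R : realType) (f : R -> R) (x : R) :
  derivable f x 1 ->
  (fun h : R => h^-1 * (f (x + h) - f x)) @ 0^' --> derive1 f x.
Proof.
move=> df; rewrite derive1E.
rewrite (_ : (fun _ => _) = fun h => h^-1 *: (f (h *: 1 + x) - f x)).
  exact: df.
by apply/funext => h; rewrite [_ *: 1]mulr1 (addrC x).
Qed.

(** The derivative is the pointwise limit of the continuous functions
    n.+1 * (f (x + 1 / n.+1) - f x). *)
Lemma measurable_derive1 (R : realType) (f : R -> R) :
  (forall x, derivable f x 1) -> measurable_fun setT (derive1 f).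
Proof.
move=> df.
pose q n (x : R) := n.+1%:R * (f (x + n.+1%:R^-1) - f x).
refine (@measurable_fun_cvg _ _ R setT q (derive1 f) _ _).
  move=> n; have mf := continuous_measurable_fun (derivable_continuous df).
  apply: measurable_funM => //; apply: measurable_funB => //.
  apply: measurableT_comp; [exact: mf|].
  exact: measurable_translate.
move=> x _.
pose g (h : R) := h^-1 * (f (x + h) - f x).
have dg := cvg_difference_quotient (df x).
pose u (n : nat) : R := n.+1%:R^-1.
have u0 n : u n != 0 by rewrite invr_neq0 // pnatr_eq0.
have gu := (cvgr_dnbhsP g 0 (derive1 f x)).1 dg u (conj u0 cvg_harmonic).
have -> : q ^~ x = g \o u by apply/funext => n; rewrite /q /= /g invrK.
exact gu.
Qed.

(** If d < 0, then f' < 0 just to the right of its zero a, so f takes there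
    values smaller than f a. The function f' need not be differentiable, nor
    even continuous, away from a. *)
Lemma derive2_ge0_at_min (R : realType) (f f' : R -> R) (a d : R) :
  (forall x : R, is_derive x 1 f (f' x)) -> is_derive a 1 f' d ->
  (forall x, f a <= f x) -> 0 <= d.
Proof.
move=> df d2f fmin.
have df1 (x : R) : derivable f x 1 := @ex_derive _ _ _ _ _ _ _ (df x).
have f1 : derive1 f = f'.
  by apply/funext => x; rewrite derive1E (@derive_val _ _ _ _ _ _ _ (df x)).
have f'a : f' a = 0.
  rewrite -f1 derive1E.
  have a1 : a - 1 <= a + 1 by lra.
  have aa : a \in `](a - 1), (a + 1)[%R by rewrite in_itv /=; lra.
  have := derive1_at_min a1 (fun t _ => df1 t) aa (fun t _ => fmin t).
  exact: @derive_val.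
rewrite leNgt; apply/negP => neg.
have := cvg_difference_quotient (@ex_derive _ _ _ _ _ _ _ d2f).
rewrite derive1E (@derive_val _ _ _ _ _ _ _ d2f) => dq.
have := cvgr_lt _ dq _ neg.
rewrite f'a => -[e /= e0 He].
have lt0 x : x \in `]a, a + e[%R -> derive1 f x < 0.
  rewrite in_itv /= f1 => /andP[ax xe].
  have xa : 0 < x - a by rewrite subr_gt0.
  have := He (x - a); rewrite /= sub0r normrN gtr0_norm // ltrBlDl.
  move=> /(_ xe (lt0r_neq0 xa)).
  by rewrite subr0 subrKC pmulr_rlt0 ?invr_gt0.
have ae : a < a + e / 2 by rewrite ltrDl divr_gt0.
have ae2 : a + e / 2 < a + e by rewrite ltrD2l ltr_pdivrMr // ltr_pMr // ltr1n.
have neg1 x : x \in `]a, a + e / 2[%R -> derive1 f x < 0.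
  rewrite in_itv /= => /andP[ax xe]; apply: lt0.
  by rewrite in_itv /= ax (lt_trans xe).
have cf : {within `[a, a + e / 2], continuous f}.
  exact/continuous_subspaceT/derivable_continuous.
have := ltr0_derive1_lt_cc (fun x _ => df1 x) neg1 cf.
move=> /(_ (a + e / 2) a); rewrite !in_itv /= !lexx (ltW ae) => /(_ isT isT ae).
by rewrite ltNge fmin.
Qed.

(** * Support functions of ovals *)

Lemma dot_continuous (R : realType) (u : R * R) :
  continuous (fun q : R * R => dot q u).
Proof.
move=> q; apply: cvgD; apply: cvgMl; [exact: cvg_fst|exact: cvg_snd].
Qed.

(** Cauchy-Schwarz, from Lagrange's identity *)
Lemma normr_dot_unit_vec_le (R : realType) (q : R * R) (t : R) :
  `|dot q (unit_vec t)| <= enorm q.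
Proof.
rewrite -sqrtr_sqr ler_wsqrtr // /dot /=.
have := cos2Dsin2 t; set c := cos t; set s := sin t => cs.
rewrite -subr_ge0.
have -> : q.1 * q.1 + q.2 * q.2 - (q.1 * c + q.2 * s) ^+ 2 =
  (q.1 * s - q.2 * c) ^+ 2 + (q.1 ^+ 2 + q.2 ^+ 2) * (1 - (c ^+ 2 + s ^+ 2)).
  by ring.
by rewrite cs subrr mulr0 addr0 sqr_ge0.
Qed.

(** The number c may be negative, hence the absolute value. The foot of the
    perpendicular from the origin is c u(t). *)
Lemma dist_origin_line (R : realType) (t c : R) :
  dist_origin (line t c) = `|c|.
Proof.
have lbc : lbound [set enorm q | q in line t c] `|c|.
  by move=> _ [q /= <- <-]; exact: normr_dot_unit_vec_le.
apply/eqP; rewrite eq_le; apply/andP; split.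
  apply: ge_inf; first by exists `|c|.
  exists (c * cos t, c * sin t).
    by rewrite /line /dot /= -!mulrA -mulrDr -!expr2 cos2Dsin2 mulr1.
  rewrite /enorm /dot /= (_ : _ + _ = c ^+ 2 * (cos t ^+ 2 + sin t ^+ 2)).
    by rewrite cos2Dsin2 mulr1 sqrtr_sqr.
  by ring.
apply: lb_le_inf lbc.
exists (enorm (c * cos t, c * sin t)), (c * cos t, c * sin t) => //.
by rewrite /line /dot /= -!mulrA -mulrDr -!expr2 cos2Dsin2 mulr1.
Qed.

(** A maximizer of <., u(t)> over K cannot be interior to K, since moving it
    by a small step in the direction u(t) would increase the maximum. *)
Lemma boundary_meets_halfplane (R : realType) (K : set (R * R)) (t : R) :
  compact K -> interior K (0, 0) ->
  exists2 q, (K `\` interior K) q & 0 <= dot q (unit_vec t).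
Proof.
move=> cK K0.
have K00 : K (0, 0) := interior_subset K0.
have [q /set_mem Kq qmax] : exists2 c, c \in K &
    forall v, v \in K -> dot v (unit_vec t) <= dot c (unit_vec t).
  apply: compact_EVT_max => //; first by exists (0, 0).
  exact/continuous_subspaceT/dot_continuous.
exists q; last first.
  by have := qmax _ (mem_set K00); rewrite /dot /= !mul0r addr0.
split => // Kiq.
have cvg_line (a b : R) : (fun e : R => a + e * b) @ 0 --> a.
  rewrite -[X in _ --> X]addr0 -[X in _ --> _ + X](mul0r b).
  by apply: cvgD; [exact: cvg_cst|apply: cvgMl; exact: cvg_id].
have cvq : (fun e : R => (q.1 + e * cos t, q.2 + e * sin t)) @ 0 --> q.
  rewrite [q in _ --> q]surjective_pairing.
  exact (cvg_pair (cvg_line q.1 (cos t)) (cvg_line q.2 (sin t))).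
have /nbhs_ballP[e /= e0 He] := cvq _ Kiq.
have : K (q.1 + e / 2 * cos t, q.2 + e / 2 * sin t).
  apply: (He (e / 2)); rewrite /ball /= sub0r normrN gtr0_norm ?divr_gt0 //.
  by rewrite ltr_pdivrMr // ltr_pMr // ltr1n.
move=> /mem_set /qmax; rewrite leNgt => /negP; apply.
rewrite /dot /= -subr_gt0.
rewrite (_ : _ - _ = e / 2 * (cos t ^+ 2 + sin t ^+ 2)); last by ring.
by rewrite cos2Dsin2 mulr1 divr_gt0.
Qed.

(** The tangent line of direction t is <., u(t)> = c with c the maximum of
    <., u(t)> over G, and p t is |c|. The origin being inside the oval, some
    point of G lies in the half-plane <., u(t)> >= 0, so c >= 0. *)
Lemma support_function_max (R : realType) (G : set (R * R)) (p : R -> R)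
    (t : R) :
  oval G -> support_function G p ->
  [/\ 0 <= p t, exists2 q, G q & dot q (unit_vec t) = p t &
      forall q, G q -> dot q (unit_vec t) <= p t].
Proof.
move=> [_ [K [_ cK -> K0]]] /(_ t)[_ [c [-> [q [qc Gq]] Gle]] ->].
have c0 : 0 <= c.
  have [r Gr r0] := boundary_meets_halfplane t cK K0.
  exact: le_trans r0 (Gle _ Gr).
by rewrite dist_origin_line ger0_norm //; split => //; exists q.
Qed.

Lemma curvature_radius_ge0 (R : realType) (G : set (R * R)) (p : R -> R)
    (t : R) :
  oval G -> support_function G p ->
  (forall s, derivable p s 1) -> derivable (derive1 p) t 1 ->
  0 <= curvature_radius p t.
Proof.
move=> oG sp dp d2p.
have [_ [q Gq qt] _] := support_function_max t oG sp.
have ple (s : R) : dot q (unit_vec s) <= p s.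
  by have [_ _] := support_function_max s oG sp; exact.
(* p - l is minimal at t, and l'' = - l *)
pose l (s : R) : R := dot q (unit_vec s).
have dl (s : R) : is_derive s 1 l (q.2 * cos s - q.1 * sin s).
  rewrite /l /dot /=; apply: is_derive_eq.
  by rewrite /GRing.scale /=; ring.
have d2l : is_derive t 1 (fun s => q.2 * cos s - q.1 * sin s) (- l t).
  by apply: is_derive_eq; rewrite /l /dot /= /GRing.scale /=; ring.
have d2pl := is_deriveB (is_derive_derive1 d2p) d2l.
have lmin (s : R) : (p - l) t <= (p - l) s.
  rewrite -[X in X <= _]/(p t - l t) -[X in _ <= X]/(p s - l s).
  by rewrite [in X in X <= _]/l qt subrr subr_ge0; exact: ple.
have := derive2_ge0_at_min
  (fun s : R => is_deriveB (is_derive_derive1 (dp s)) (dl s)) d2pl lmin.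
by rewrite opprK /l qt addrC.
Qed.

(** * Equidistant sums over a period *)

Lemma sum_shift_derive_eq0 (R : realType) (f f' : R -> R) (h c : R) (N : nat) :
  (forall x : R, is_derive x 1 f (f' x)) ->
  (forall x, \sum_(k < N) f (x + h * k%:R) = c) ->
  forall x, \sum_(k < N) f' (x + h * k%:R) = 0.
Proof.
move=> df sumf x.
pose F (k : 'I_N) (y : R) := f (y + h * k%:R).
have dF (k : 'I_N) : is_derive x 1 (F k) (f' (x + h * k%:R)).
  have dt : is_derive x 1 (fun y : R => y + h * k%:R) 1.
    exact: is_derive_shift.
  have := @is_derive1_comp _ f (fun y : R => y + h * k%:R) x _ _ (df _) dt.
  by rewrite mulr1.
have dsum := is_derive_sum dF.
rewrite -(@derive_val _ _ _ _ _ _ _ dsum).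
rewrite (_ : \sum_(i < N) F i = cst c) ?derive_cst //.
by apply/funext => y; rewrite fct_sumE -(sumf y).
Qed.

Lemma integral_itv_cst (R : realType) (h c : R) :
  0 <= h -> integral 0 h (fun=> c) = c * h.
Proof.
move=> h0; rewrite /integral Rintegral_cst //= lebesgue_measure_itv /= lte_fin.
by case: ltgtP h0 => // [|<-] _; rewrite /= ?subr0.
Qed.

Lemma integral_period_sum_cst (R : realType) (f : R -> R) (h c : R) (N : nat) :
  measurable_fun setT f -> (forall x, 0 <= f x) -> 0 <= h ->
  (forall x, \sum_(k < N) f (x + h * k%:R) = c) ->
  integral 0 (h * N%:R) f = c * h.
Proof.
move=> mf f0 h0 sumf; rewrite integral_fold // (_ : (fun x => _) = fun=> c).
  exact: integral_itv_cst.
by apply/funext => x; exact: sumf.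
Qed.

Lemma integral_width (R : realType) (p : R -> R) :
  measurable_fun setT p -> (forall x, 0 <= p x) ->
  integral 0 pi (width p) = integral 0 (2 * pi) p.
Proof.
move=> mp p0; rewrite [2 * pi]mulrC integral_fold ?pi_ge0 //.
congr integral; apply/funext => x.
by rewrite big_ord_recr big_ord_recl big_ord0 /= mulr0 mulr1 !addr0.
Qed.

(** * Curvature of an oval of degree m *)

Theorem mainTheorem1 (R : realType) (Gamma : set (R * R)) (p : R -> R)
    (m : nat)
    (Gamma_oval : oval Gamma)
    (p_support : support_function Gamma p)
    (p_fourier : twice_differentiable_fourier_series p)
    (Gamma_degree : has_degree p m) :
  let rho := curvature_radius p in
  let w_bar := average_width p in
  [/\ forall t : R, \sum_(k < 2 ^ m) rho (t + 2 * pi * k%:R / 2 ^+ m)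
                = (2 : R) ^ (m%:Z - 1) * w_bar,
      average_curvature_radius p = w_bar / 2 &
      forall t, 0 <= rho t <= (2 : R) ^ (m%:Z - 1) * w_bar].
Proof.
move=> rho w_bar.
have [_ dp d2p] := p_fourier.
have [avg_cst _] := Gamma_degree.
have p0 x : 0 <= p x by have [] := support_function_max x Gamma_oval p_support.
have rho0 x : 0 <= rho x.
  exact: (curvature_radius_ge0 Gamma_oval p_support dp (d2p x)).
have mp : measurable_fun setT p.
  exact (continuous_measurable_fun (derivable_continuous dp)).
have mrho : measurable_fun setT rho.
  exact (measurable_funD mp (measurable_derive1 d2p)).
have pow0 : (2 ^+ m : R) != 0 by rewrite expf_neq0 // pnatr_eq0.
pose h : R := 2 * pi / 2 ^+ m.
have h0 : 0 <= h by rewrite divr_ge0 ?exprn_ge0 ?mulr_ge0 ?pi_ge0.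
have hN : h * (2 ^ m)%:R = 2 * pi by rewrite natrX divfK.
have shiftE (x : R) k : x + 2 * pi * k%:R / 2 ^+ m = x + h * k%:R.
  by rewrite /h mulrAC.
pose C := 2 ^+ m * shift_average p m 0.
have sum_p x : \sum_(k < 2 ^ m) p (x + h * k%:R) = C.
  rewrite /C (avg_cst 0 x) /shift_average mulVKf //.
  by apply: eq_bigr => k _; rewrite shiftE.
have sum_p1 :=
  sum_shift_derive_eq0 (fun x : R => is_derive_derive1 (dp x)) sum_p.
have sum_p2 :=
  sum_shift_derive_eq0 (fun x : R => is_derive_derive1 (d2p x)) sum_p1.
have sum_rho x : \sum_(k < 2 ^ m) rho (x + h * k%:R) = C.
  by rewrite /rho /curvature_radius big_split /= sum_p sum_p2 addr0.
have pi_neq0 : (pi : R) != 0 by rewrite gt_eqF // pi_gt0.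
have ChE : C * h = pi * (2 * C / 2 ^+ m) by rewrite /h; ring.
have int_p : integral 0 (2 * pi) p = pi * (2 * C / 2 ^+ m).
  by rewrite -ChE -hN; exact: integral_period_sum_cst.
have int_rho : integral 0 (2 * pi) rho = pi * (2 * C / 2 ^+ m).
  by rewrite -ChE -hN; exact: integral_period_sum_cst.
have w_barE : w_bar = 2 * C / 2 ^+ m.
  rewrite /w_bar /average_width integral_width // int_p.
  exact: mulKf.
have wE : (2 : R) ^ (m%:Z - 1) * w_bar = C.
  by rewrite w_barE expfzDr ?pnatr_eq0 // -exprnP exprN1; field.
split.
- by move=> t; rewrite wE -(sum_rho t); apply: eq_bigr => k _; rewrite shiftE.
- rewrite /average_curvature_radius int_rho w_barE invfM -[LHS]mulrA.
  by rewrite (mulKf pi_neq0) mulrC.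
- (* rho t is the term k = 0 of the sum *)
  move=> t; rewrite rho0 wE -(sum_rho t) /=.
  have m0 : (0 < 2 ^ m)%N by rewrite expn_gt0.
  rewrite (bigD1 (Ordinal m0)) //= mulr0 addr0 lerDl.
  by apply: sumr_ge0 => k _; exact: rho0.
Qed.
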